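(* Let $d\geq 1$ be a fixed integer, and let $p=p(n)=w(n)/n$ be a probability depending on the positive integer $n$ (so $0\leq p(n)\leq 1$). Then $p(n)=\Theta\left(\frac{1}{n}\right)$ is the threshold probability for vanishing of the top homology of the random simplicial $d$-complex $Y_{n,p,d}$, which more precisely means the following: \begin{enumerate} \item if $\lim_{n\to\infty} w(n)=0$, then $\lim_{n\to\infty}\mathrm{Prob}(\beta_d(Y_{n,p,d};\mathbb{Z}_2)=0)=1$; \item if $\lim_{n\to\infty} w(n)=\infty$, then $\lim_{n\to\infty}\mathrm{Prob}(\beta_d(Y_{n,p,d};\mathbb{Z}_2)>0)=1$. \end{enumerate}
   Context: For a positive integer $n$, $\Delta_n$ denotes the full $(n-1)$-dimensional simplex (on $n$ vertices). For a simplicial complex $\Delta$ and an integer $k\ge 0$, $\Delta^{(k)}$ denotes the $k$-dimensional skeleton of $\Delta$ and $\Delta(k)$ denotes the set of $k$-simplices of $\Delta$. For positive integers $n,d$ and a real number $0\leq p\leq 1$, $Y_{n,p,d}$ denotes the probability space whose underlying set consists of all simplicial complexes $\Delta$ on $n$ vertices (subcomplexes of $\Delta_n$) such that $\Delta^{(d-1)}=\Delta_n^{(d-1)}$ and $\Delta(d+1)=\emptyset$ (that is, $\Delta$ has dimension at most $d$ and contains the full $(d-1)$-skeleton), where the probability of $\Delta$ is $p^{|\Delta(d)|}(1-p)^{\binom{n}{d+1}-|\Delta(d)|}$; i.e. each $d$-simplex is included independently with probability $p$. $\mathrm{Prob}(\beta_d(Y_{n,p,d};\mathbb{Z}_2)=0)$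 and $\mathrm{Prob}(\beta_d(Y_{n,p,d};\mathbb{Z}_2)>0)$ denote the probabilities that, for $\Delta$ sampled from $Y_{n,p,d}$, the $d$-th Betti number $\dim_{\mathbb{Z}_2}H_d(\Delta;\mathbb{Z}_2)$ is equal to $0$, respectively strictly larger than $0$. Here $\mathbb{Z}_2$ is the field with two elements. *)

(* Defs.v *)
From HB Require Import structures.
From mathcomp Require Import all_boot all_order all_algebra.

Set Implicit Arguments.
Unset Strict Implicit.
Unset Printing Implicit Defensive.

Import Order.TTheory GRing.Theory Num.Theory.

Local Open Scope ring_scope.

Section Complexes.
Variable n : nat.
Implicit Types (D : {set {set 'I_n}}) (s t : {set 'I_n}).

(* Simplices are nonempty, so the empty face never belongs to a complex; a
   k-simplex has k.+1 vertices. *)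
Definition simplicial_complex D :=
  (set0 \notin D) &&
  [forall s in D, forall t : {set 'I_n}, (t != set0) && (t \subset s) ==> (t \in D)].

Definition full_simplex : {set {set 'I_n}} := [set s | s != set0].

Definition simplices k D := [set s in D | #|s| == k.+1].

Definition skeleton k D := [set s in D | (#|s| <= k.+1)%N].

Definition chain := {ffun {set 'I_n} -> ('F_2)^o}.

Definition simplex_chain s : chain := [ffun t => (t == s)%:R].

(* The restriction to nonempty faces makes the boundary of a vertex zero, i.e.
   homology is not reduced. *)
Definition simplex_boundary s : chain :=
  \sum_(v in s | s :\ v != set0) simplex_chain (s :\ v).

Definition boundary (c : chain) : chain := \sum_s c s *: simplex_boundary s.

Lemma boundary_is_linear : linear boundary.
Proof.
move=> a c1 c2; rewrite /boundary scaler_sumr -big_split /=.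
by apply: eq_bigr => s _; rewrite !ffunE scalerDl scalerA.
Qed.

HB.instance Definition _ :=
  GRing.isLinear.Build 'F_2 chain chain *:%R boundary boundary_is_linear.

Definition chains k D : {vspace chain} :=
  <<[seq simplex_chain s | s <- enum (simplices k D)]>>%VS.

Definition cycles k D : {vspace chain} :=
  (chains k D :&: lker (linfun boundary))%VS.

Definition boundaries k D : {vspace chain} :=
  (linfun boundary @: chains k.+1 D)%VS.

(* The quotient of cycles by boundaries, realised as a complement of the
   boundaries inside the cycles; see [homology_cycles] and [betti_cycles]. *)
Definition homology k D : {vspace chain} := (cycles k D :\: boundaries k D)%VS.

Definition betti k D := \dim (homology k D).

Lemma boundary_simplex s : boundary (simplex_chain s) = simplex_boundary s.
Proof.
rewrite /boundary (bigD1 s) //= ffunE eqxx scale1r big1 ?addr0 // => t ts.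
by rewrite ffunE (negbTE ts) scale0r.
Qed.

Lemma boundary_simplex_boundary s : boundary (simplex_boundary s) = 0.
Proof.
rewrite /simplex_boundary linear_sum /=.
under eq_bigr do rewrite boundary_simplex.
apply/ffunP => t; rewrite sum_ffunE ffunE.
pose F v u : 'F_2 := simplex_chain ((s :\ v) :\ u) t.
pose P v u := [&& v \in s, u \in s, v != u & (s :\ v) :\ u != set0].
transitivity (\sum_v \sum_(u | P v u) F v u).
  rewrite big_mkcond /=; apply: eq_bigr => v _.
  case: ifP => [/andP[vs nv]|h].
    rewrite sum_ffunE; apply: eq_bigl => u.
    by rewrite /P vs !inE eq_sym; case: (v == u); case: (u \in s).
  rewrite big_pred0 // => u; apply/negP => /and4P[vs us vu ne].
  move: h; rewrite vs /= => /negbT; rewrite negbK => /eqP h.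
  by move: ne; rewrite h set0D eqxx.
have Psym v u : P v u = P u v.
  by rewrite /P eq_sym !setDDl setUC; case: (v \in s); case: (u \in s).
have Fsym v u : F v u = F u v by rewrite /F !setDDl setUC.
pose Q v u := P v u && (v < u)%N.
have split v : \sum_(u | P v u) F v u
    = \sum_(u | Q v u) F v u + \sum_(u | Q u v) F v u.
  rewrite (bigID (fun u : 'I_n => (v < u)%N)) /=; congr (_ + _).
  apply: eq_bigl => u; rewrite /Q Psym -leqNgt leq_eqVlt.
  case e: (val u == val v) => //=.
  by rewrite /P (val_inj (eqP e)) eqxx !andbF.
under eq_bigr do rewrite split.
rewrite big_split /= [X in _ + X](exchange_big_dep xpredT) //=.
under [X in _ + X]eq_bigr do under eq_bigr do rewrite Fsym.
by rewrite -mulr2n -mulr_natl (_ : 2%:R = 0 :> 'F_2) ?mul0r //; apply/eqP.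
Qed.

Lemma boundary_boundary c : boundary (boundary c) = 0.
Proof.
rewrite {2}/boundary linear_sum big1 // => s _.
by rewrite linearZ /= boundary_simplex_boundary scaler0.
Qed.

Lemma simplex_boundary_chains k D s :
  simplicial_complex D -> s \in simplices k.+1 D ->
  simplex_boundary s \in chains k D.
Proof.
move=> /andP[_ /forall_inP cD]; rewrite inE => /andP[sD /eqP cs].
apply: memv_suml => v /andP[vs nv]; apply: memv_span; apply: map_f.
have c1 : #|s :\ v| = k.+1 by move: (cardsD1 v s); rewrite vs cs => -[].
rewrite mem_enum inE c1 eqxx andbT.
by have /forallP/(_ (s :\ v))/implyP := cD s sD; apply; rewrite nv subsetDl.
Qed.

Lemma boundaries_cycles k D :
  simplicial_complex D -> (boundaries k D <= cycles k D)%VS.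
Proof.
move=> cD; rewrite subv_cap; apply/andP; split.
  rewrite /boundaries limg_span -map_comp; apply/span_subvP => _ /mapP[s sD ->].
  rewrite /= lfunE /= boundary_simplex simplex_boundary_chains //.
  by rewrite mem_enum in sD.
apply/subvP => _ /memv_imgP[c _ ->].
by rewrite memv_ker !lfunE /= boundary_boundary.
Qed.

Lemma homology_cycles k D : simplicial_complex D ->
  (homology k D + boundaries k D)%VS = cycles k D /\
  (homology k D :&: boundaries k D)%VS = 0%VS.
Proof.
move=> /(boundaries_cycles k) /capv_idPr bz; split; last exact: capv_diff.
by rewrite addv_diff; apply/addv_idPl; apply/capv_idPr.
Qed.

Lemma betti_cycles k D : simplicial_complex D ->
  betti k D = (\dim (cycles k D) - \dim (boundaries k D))%N.
Proof.
move=> /(boundaries_cycles k) /capv_idPr bz.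
by rewrite -(dimv_cap_compl (cycles k D) (boundaries k D)) bz addKn.
Qed.

End Complexes.

Definition Y_space (n d : nat) : {set {set {set 'I_n}}} :=
  [set D | [&& simplicial_complex D,
               skeleton d.-1 D == skeleton d.-1 (full_simplex n)
             & simplices d.+1 D == set0]].

Definition Y_mass (R : realFieldType) (n : nat) (p : R) (d : nat)
    (D : {set {set 'I_n}}) : R :=
  p ^+ #|simplices d D| * (1 - p) ^+ ('C(n, d.+1) - #|simplices d D|).

Definition Y_prob (R : realFieldType) (n : nat) (p : R) (d : nat)
    (E : pred {set {set 'I_n}}) : R :=
  \sum_(D in Y_space n d | E D) Y_mass p d D.


Lemma Y_space_card n d D s : (0 < d)%N -> D \in Y_space n d -> s \in D ->
  (#|s| <= d.+1)%N.
Proof.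
move=> d0; rewrite inE => /and3P[/andP[_ /forall_inP cD] _ /eqP D0] sD.
rewrite leqNgt; apply/negP => lt.
have : (0 < #|[set t : {set 'I_n} | t \subset s & #|t| == d.+2]|)%N.
  by rewrite cards_draws bin_gt0.
rewrite card_gt0 => /set0Pn[t]; rewrite inE => /andP[ts ct].
have /forallP/(_ t)/implyP tD := cD s sD.
have : t \in simplices d.+1 D.
  by rewrite inE ct andbT; apply: tD; rewrite ts andbT -card_gt0 (eqP ct).
by rewrite D0 inE.
Qed.

Lemma Y_prob_total (R : realFieldType) (n : nat) (p : R) (d : nat) :
  (0 < d)%N -> Y_prob (n := n) p d xpredT = 1.
Proof.
case: d => // d _; pose S := simplices d.+1 (full_simplex n).
have simplS k D : simplicial_complex D ->
    simplices k D \subset simplices k (full_simplex n).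
  move=> /andP[n0 _]; apply/subsetP => s; rewrite !inE => /andP[sD ->].
  by rewrite andbT; apply: contraNneq n0 => <-.
have cS : #|S| = 'C(n, d.+2).
  rewrite -[n in RHS]card_ord -card_draws; apply: eq_card => s; rewrite !inE.
  by case cs: (#|s| == _); rewrite ?andbF // andbT -card_gt0 (eqP cs).
pose h (A : {set {set 'I_n}}) := skeleton d (full_simplex n) :|: A.
rewrite /Y_prob /Y_mass (reindex_onto h (simplices d.+1)) /=; last first.
  move=> D; rewrite andbT => YD.
  have := YD; rewrite inE => /and3P[cD /eqP sk _].
  apply/setP => s; rewrite /h -sk !inE /=.
  have [sD|//] := boolP (s \in D); rewrite /=.
  by rewrite orbC -leq_eqVlt (Y_space_card _ YD).
have hP (A : {set {set 'I_n}}) : A \subset S -> simplices d.+1 (h A) = A.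
  move=> /subsetP AS; apply/setP => s; rewrite !inE.
  have [/AS|_] := boolP (s \in A); first by rewrite inE orbT => /andP[].
  by rewrite orbF; case cs: (#|s| == _); rewrite ?andbF // (eqP cs) ltnn !andbF.
rewrite (eq_bigl (fun A : {set {set 'I_n}} => A \subset S)); last first.
  move=> A; apply/idP/idP => [/andP[]|AS].
    by rewrite andbT inE => /and3P[cD _ _] /eqP <-; exact: simplS.
  rewrite hP // eqxx !andbT inE; have /subsetP AS' := AS.
  apply/and3P; split.
  - apply/andP; split.
      rewrite !inE eqxx /=; apply/negP => /AS'; by rewrite !inE eqxx.
    apply/forall_inP => s sh; apply/forallP => t; apply/implyP=> /andP[t0 ts].
    have [->//|ne] := eqVneq t s; rewrite !inE t0 /=; apply/orP; left.
    have lt : (#|t| < #|s|)%N by apply: proper_card; rewrite properEneq ne.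
    rewrite -ltnS (leq_trans lt) //.
    move: sh; rewrite !inE => /orP[/andP[_ /leqW //]|/AS'].
    by rewrite !inE => /andP[_ /eqP ->].
  - apply/eqP/setP => s; rewrite !inE.
    have [/AS'|_] := boolP (s \in A); last by rewrite orbF -andbA andbb.
    by rewrite !inE orbT => /andP[-> /eqP ->].
  - apply/eqP/setP => s; rewrite !inE.
    have [/AS'|_] := boolP (s \in A).
      by rewrite !inE => /andP[_ /eqP ->]; rewrite !eqSS (ltn_eqF (ltnSn d)) andbF.
    rewrite orbF; case cs: (#|s| == _); rewrite ?andbF // (eqP cs) andbT.
    by rewrite !ltnS ltnNge leqnSn andbF.
rewrite -cS (partition_big (fun A : {set {set 'I_n}} => inord #|A| : 'I_#|S|.+1)
  xpredT) //=.
transitivity ((1 - p + p) ^+ #|S|); last by rewrite subrK expr1n.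
rewrite exprDn.
apply: eq_bigr => k _; rewrite -cards_draws -sumr_const.
under [RHS]eq_bigl do rewrite inE.
apply: eq_big => [A|A /andP[AS /eqP <-]].
  case AS: (A \subset S) => //=.
  by rewrite -val_eqE /= inordK // ltnS subset_leq_card.
by rewrite hP // inordK ?ltnS ?subset_leq_card // mulrC.
Qed.

(* Main.v *)
Require Import Defs.
From mathcomp Require Import all_boot all_order all_algebra.
From mathcomp Require Import all_classical all_reals all_analysis.
From mathcomp Require Import zify ring lra.
From mathcomp Require Import fintype finset.
Import Order.TTheory GRing.Theory Num.Theory.
Import numFieldNormedType.Exports.
Set Implicit Arguments.
Unset Strict Implicit.
Unset Printing Implicit Defensive.
Local Open Scope ring_scope.

(** Only upper bounds on the probability of the two exceptional events are
needed, and each comes from an elementary moment estimate. As there are no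
[(d+1)]-simplices, the top homology is the space of [d]-cycles, and over the
field with two elements a [d]-cycle is a family of [d]-simplices that covers
every [(d-1)]-simplex an even number of times.

Throughout, [w = n p].

Dense regime. The boundary map sends the [d]-chains into a space of dimension at
most [C(n, d)], so a complex with more than [C(n, d)] simplices of dimension [d]
has a cycle ([few_simplices_of_betti0]). The number of [d]-simplices is binomial
with mean [p C(n, d+1)], which is about [w / (d+1)] times [C(n, d)]; Markov's
inequality for [2 ^ (- X)] shows that it is at most [C(n, d)] with probability
[O(1/w)] ([prob_betti0_le_inv]).

Sparse regime. A nonzero cycle contains a circuit, that is, a minimal nonempty
even family, and the circuits are counted through their set [V] of vertices, of
size [v]. Two facts carry the argument.
- A circuit on [V] has at least [v] simplices, as each vertex lies in at least
  [d+1] of them ([card_cover_cycle]).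
- There are at most [v ^ (d + m)] circuits of [m] simplices on [V]
  ([card_circuits_on]): a proper nonempty subfamily of a circuit is not even, so
  the circuit must contain another simplex through a face determined by the
  subfamily, and this simplex is given by one vertex of [V]. A circuit is thus
  described by a first simplex and [m - 1] vertices.
Hence the expected number of circuits on [V] is at most the geometric tail
[v ^ d (sum over m >= v of (v p) ^ m) <= 2 v ^ d (v p) ^ v]. There are [C(n, v)]
sets [V], and [C(n, v) v ^ v <= (4 n) ^ v], so in total the expected number of
circuits is at most a constant times the sum of [(8 n p) ^ v] over [v >= 1],
which is [O(w)] ([prob_betti_gt0_le]). *)

(** * Binomial estimates *)

Lemma ffact_leq_expn n k : (n ^_ k <= n ^ k)%N.
Proof.
rewrite ffact_prod -[X in (_ <= n ^ X)%N]card_ord -prod_nat_const.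
by apply: leq_prod => i _; exact: leq_subr.
Qed.

Lemma bin_leq_exp2 k m : ('C(k, m) <= 2 ^ k)%N.
Proof.
rewrite -[k in 'C(k, _)]card_ord -[k in (2 ^ k)%N]card_ord -cardsT.
rewrite -card_powerset -cards_draws.
by apply: subset_leq_card; apply/subsetP => A; rewrite !inE => /andP[].
Qed.

(** With [k = m] this is the estimate [m ^ m <= 4 ^ m m!], and with [m] fixed it
says that polynomials in [k] are dominated by [2 ^ k]: in both cases
[k ^ m <= (k + m) ^_ m = C(k + m, m) m!]. *)
Lemma leq_expn_fact k m : (k ^ m <= 2 ^ (k + m) * m`!)%N.
Proof.
apply: (@leq_trans ((k + m) ^_ m)).
  rewrite ffact_prod -[X in (k ^ X <= _)%N]card_ord -prod_nat_const.
  by apply: leq_prod => i _; have := ltn_ord i; lia.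
by rewrite -bin_ffact leq_mul2r bin_leq_exp2 orbT.
Qed.

Lemma bin_expn_le n v : ('C(n, v) * v ^ v <= (4 * n) ^ v)%N.
Proof.
apply: (@leq_trans ('C(n, v) * (2 ^ (v + v) * v`!))).
  by rewrite leq_mul2l leq_expn_fact orbT.
rewrite addnn -mul2n expnM mulnCA bin_ffact expnMn leq_mul2l.
by rewrite ffact_leq_expn orbT.
Qed.

(** * Even families of faces and circuits *)

Section EvenFamilies.
Local Open Scope nat_scope.
Variable T : finType.
Implicit Types (s t V : {set T}) (A Z : {set {set T}}).

Definition facet t s := (t \subset s) && (#|s| == #|t|.+1).

Definition mod2_cycle Z := [forall t, ~~ odd #|[set s in Z | facet t s]|].

(** The circuits of the matroid of columns of the incidence matrix between facets
and faces, over the field with two elements. *)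
Definition circuit Z := minset (fun Z' => (Z' != set0) && mod2_cycle Z') Z.

Lemma facetD1 s x : x \in s -> facet (s :\ x) s.
Proof. by move=> xs; rewrite /facet subsetDl (cardsD1 x s) xs /=. Qed.

Lemma facetU1 t s : facet t s -> exists2 x, x \in s & s = x |: t.
Proof.
move=> /andP[ts /eqP cs].
have /eqP/cards1P[x sx] : #|s :\: t| = 1.
  by rewrite cardsD (setIidPr ts) cs subSn ?subnn.
have /setDP[xs _] : x \in s :\: t by rewrite sx set11.
exists x => //; rewrite -sx setUC.
by rewrite -[s in LHS](setID s t) (setIidPr ts).
Qed.

(** An even number that is not zero is not one. *)
Lemma mod2_cycle_other Z t s : mod2_cycle Z -> s \in Z -> facet t s ->
  exists s', [/\ s' \in Z, s' != s & facet t s'].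
Proof.
move=> /forallP/(_ t) even sZ fts.
have sF : s \in [set s in Z | facet t s] by rewrite inE sZ.
move: even; rewrite (cardsD1 s) sF /= negbK => odd1.
have /set0Pn[s'] : [set s in Z | facet t s] :\ s != set0.
  by rewrite -card_gt0; case: #|_| odd1.
by rewrite !inE => /andP[ne /andP[s'Z fs']]; exists s'.
Qed.

(** For each vertex [y != x] of [s], evenness at the face [s :\ y] gives another
member [h y] of [Z] that contains [x]; with [h x := s], these [d + 1] members are
distinct because [h y] avoids [y] whereas it contains all other vertices of
[s]. *)
Lemma mod2_cycle_degree Z d s x : mod2_cycle Z ->
  s \in Z -> x \in s -> #|s| = d.+1 -> d < #|[set s' in Z | x \in s']|.
Proof.
move=> cZ sZ xs <-.
pose g y := odflt s [pick s' in Z | (s' != s) && facet (s :\ y) s'].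
pose h y := if y == x then s else g y.
have gP y : y \in s -> [/\ g y \in Z, g y != s & facet (s :\ y) (g y)].
  move=> ys; rewrite /g; case: pickP => [s' /and3P[] //|no].
  have [s' [s'Z ne fs']] := mod2_cycle_other cZ sZ (facetD1 ys).
  by move: (no s'); rewrite s'Z ne fs'.
have sub y y' : y \in s -> y' \in s -> y != y' -> y \in h y'.
  move=> ys y's ne; rewrite /h; case: ifP => // _.
  have [_ _ /andP[/subsetP sub _]] := gP y' y's.
  by apply: sub; rewrite !inE ne.
have notin y : y \in s -> y != x -> y \notin h y.
  move=> ys ne; rewrite /h (negbTE ne).
  have [_ nes /andP[sub' /eqP cg]] := gP y ys.
  apply: contra nes => yg; rewrite eq_sym eqEcard.
  rewrite cg -add1n -[X in X + _]/(true : nat) -ys -cardsD1 leqnn andbT.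
  by rewrite -(setD1K ys) subUset sub1set yg.
have inj : {in s &, injective h}.
  move=> y y' ys y's eqh; apply/eqP/negPn/negP => ne.
  have [yx|nyx] := eqVneq y x; last first.
    by have := notin y ys nyx; rewrite eqh sub.
  have ny'x : y' != x by rewrite -yx eq_sym.
  by have := notin y' y's ny'x; rewrite -eqh sub // eq_sym.
rewrite -(card_in_imset inj); apply: subset_leq_card.
apply/subsetP => _ /imsetP[y ys ->]; rewrite inE.
have [->|ne] := eqVneq y x; first by rewrite /h eqxx sZ.
rewrite (sub x y) // 1?eq_sym // andbT /h (negbTE ne).
by have [] := gP y ys.
Qed.

(** Double counting of the incidences: each vertex lies in at least [d + 1]
members, and each member has [d + 1] vertices. *)
Lemma card_cover_cycle Z d : mod2_cycle Z ->
  Z \subset [set s : {set T} | #|s| == d.+1] -> #|cover Z| <= #|Z|.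
Proof.
move=> cZ /subsetP uZ.
rewrite -(leq_pmul2r (ltn0Sn d)).
have -> : #|Z| * d.+1 = \sum_x #|[set s in Z | x \in s]|.
  transitivity (\sum_(s in Z) #|s|).
    rewrite -sum_nat_const; apply: eq_bigr => s /uZ.
    by rewrite inE => /eqP.
  under eq_bigr do rewrite -sum1_card.
  rewrite (exchange_big_dep xpredT) //=; apply: eq_bigr => x _.
  by rewrite -sum1_card; apply: eq_bigl => s; rewrite inE.
rewrite -sum_nat_const big_mkcond; apply: leq_sum => x _.
case: ifP => // /bigcupP[s sZ xs].
by apply: (mod2_cycle_degree cZ sZ xs); move: (uZ _ sZ); rewrite inE => /eqP.
Qed.

Lemma circuit_cycle Z : circuit Z -> mod2_cycle Z.
Proof. by move=> /minsetp/andP[]. Qed.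

Lemma circuit_neq0 Z : circuit Z -> Z != set0.
Proof. by move=> /minsetp/andP[]. Qed.

Lemma circuit_exists Z : Z != set0 -> mod2_cycle Z ->
  exists2 Z', circuit Z' & Z' \subset Z.
Proof.
move=> Z0 cZ; pose P Z' := (Z' != set0) && mod2_cycle Z'.
by have [|Z' minZ' sub] := @minset_exists _ P Z; [exact/andP | exists Z'].
Qed.

Lemma card_bigcup_le (I J : finType) (B : {set I}) (F : I -> {set J}) k m :
  #|B| <= k -> (forall i, i \in B -> #|F i| <= m) ->
  #|\bigcup_(i in B) F i| <= k * m.
Proof.
move=> cB cF; apply: (@leq_trans (\sum_(i in B) #|F i|)).
  elim/big_ind2: _ => [|X a Y b aX bY|//]; first by rewrite cards0.
  by rewrite cardsU (leq_trans (leq_subr _ _)) // leq_add.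
apply: (@leq_trans (\sum_(i in B) m)); first exact: leq_sum.
by rewrite sum_nat_const leq_mul2r cB orbT.
Qed.

(** Completing a nonempty subfamily [A] to a circuit costs one vertex per added
face. If [A] is even, then minimality leaves only [A] itself. Otherwise some [f]
lies in oddly many members of [A]; as the circuit is even it has a further
member through [f], of the form [x |: f], and [f] depends on [A] alone, so
choosing [x] in [V] reduces to the count for [(x |: f) |: A]. *)
Lemma card_circuits_above V A m : A != set0 ->
  #|[set Z | [&& circuit Z, A \subset Z, cover Z \subset V
               & #|Z| == #|A| + m]]| <= #|V| ^ m.
Proof.
elim: m A => [|m IHm] A A0.
  rewrite expn0 -(cards1 A); apply: subset_leq_card; apply/subsetP => Z.
  rewrite !inE addn0 => /and4P[_ AZ _ cZ].
  by rewrite eq_sym eqEcard AZ (eqP cZ) leqnn.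
have [cA|] := boolP (mod2_cycle A).
  rewrite (_ : [set Z | _] = set0) ?cards0 //; apply/setP => Z; rewrite !inE.
  apply/negP => /and4P[/minsetinf minZ AZ _].
  by rewrite -(minZ A) ?A0 // -[X in X == _]addn0 eqn_add2l.
rewrite negb_forall => /existsP[f]; rewrite negbK => oddf.
pose B x := [set Z | [&& circuit Z, (x |: f) |: A \subset Z, cover Z \subset V
               & #|Z| == #|(x |: f) |: A| + m]].
rewrite expnS.
apply: (@leq_trans #|\bigcup_(x in V) B x|); last first.
  apply: card_bigcup_le => // x _; apply: IHm.
  by apply/set0Pn; exists (x |: f); rewrite setU11.
apply: subset_leq_card; apply/subsetP => Z.
rewrite inE => /and4P[circZ AZ ZV /eqP cZ].
(* The members of [Z] through [f] include those of [A], with a different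
   parity. *)
have /set0Pn[s] : [set s in Z | facet f s] :\: [set s in A | facet f s] != set0.
  apply: contraL (circuit_cycle circZ); rewrite setD_eq0 => ZA.
  rewrite negb_forall; apply/existsP; exists f; rewrite negbK.
  congr odd: oddf; apply: eq_card => s; apply/idP/idP; last first.
    by move/(subsetP ZA).
  by rewrite !inE => /andP[/(subsetP AZ) -> ->].
rewrite !inE => /andP[nA /andP[sZ fs]]; rewrite fs andbT in nA.
have [x xs sE] := facetU1 fs.
apply/bigcupP; exists x.
  by apply: (subsetP ZV); apply/bigcupP; exists s.
by rewrite inE circZ ZV -sE subUset sub1set sZ AZ cardsU1 nA cZ addSnnS /=.
Qed.

(** The first member of the circuit is one of at most [#|V| ^ d.+1] sets; the
other members are counted by [card_circuits_above]. *)
Lemma card_circuits_on V d m :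
  #|[set Z | [&& circuit Z, Z \subset [set s : {set T} | #|s| == d.+1],
               cover Z \subset V & #|Z| == m]]| <= #|V| ^ (d + m).
Proof.
case: m => [|m].
  rewrite (_ : [set Z | _] = set0) ?cards0 //; apply/setP => Z; rewrite !inE.
  apply/negP => /and4P[/circuit_neq0 Z0 _ _].
  by rewrite cards_eq0 (negbTE Z0).
pose B s := [set Z | [&& circuit Z, [set s] \subset Z, cover Z \subset V
               & #|Z| == #|[set s]| + m]].
pose S := [set s : {set T} | s \subset V & #|s| == d.+1].
apply: (@leq_trans #|\bigcup_(s in S) B s|).
  apply: subset_leq_card; apply/subsetP => Z; rewrite inE.
  move=> /and4P[circZ uZ ZV cZ].
  have /set0Pn[s sZ] := circuit_neq0 circZ.
  apply/bigcupP; exists s; last by rewrite inE circZ ZV cards1 cZ sub1set sZ.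
  rewrite inE; have := subsetP uZ s sZ; rewrite inE => ->; rewrite andbT.
  by apply/subsetP => x xs; apply: (subsetP ZV); apply/bigcupP; exists s.
rewrite -addSnnS expnD; apply: card_bigcup_le => [|s _].
  rewrite cards_draws -(leq_pmul2r (fact_gt0 d.+1)) bin_ffact.
  apply: leq_trans (leq_pmulr _ (fact_gt0 _)).
  exact: ffact_leq_expn.
by apply: card_circuits_above; rewrite -card_gt0 cards1.
Qed.

End EvenFamilies.

(** * Top homology through even families *)

Section TopHomology.
Variable n : nat.
Implicit Types (D : {set {set 'I_n}}) (s t : {set 'I_n}) (c : chain n).

Lemma simplex_boundaryE s t : t != set0 ->
  simplex_boundary s t = (facet t s)%:R.
Proof.
move=> t0; rewrite /simplex_boundary sum_ffunE.
under eq_bigr do rewrite ffunE.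
have [/[dup] fts /facetU1[x xs sE]|nf] := boolP (facet t s); last first.
  apply: big1 => v /andP[vs _]; case: eqVneq => // tE.
  by rewrite tE facetD1 in nf.
have xt : x \notin t.
  move: fts; rewrite /facet sE cardsU1; case: (x \in t) => //.
  by rewrite add0n ltn_eqF ?andbF.
have tE : s :\ x = t by rewrite sE setU1K.
rewrite (bigD1 x) /= ?xs ?tE ?t0 // eqxx big1 ?addr0 // => v /andP[/andP[vs _] vx].
case: eqVneq => // tv; have : v \notin t by rewrite tv !inE eqxx.
by rewrite -tE !inE vx vs.
Qed.

Lemma boundaryE c t : t != set0 ->
  boundary c t = \sum_(s | facet t s) c s.
Proof.
move=> t0; rewrite /boundary sum_ffunE big_mkcond [RHS]big_mkcond.
apply: eq_bigr => s _; rewrite ffunE simplex_boundaryE //.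
by case: facet; rewrite ?scaler0 // /GRing.scale /= mulr1.
Qed.

Lemma chains_nth k D i : (i < #|simplices k D|)%N ->
  [seq simplex_chain s | s <- enum (simplices k D)]`_i =
  simplex_chain (nth set0 (enum (simplices k D)) i).
Proof. by move=> lt; rewrite (nth_map set0) // -cardE. Qed.

Lemma chains_support k D c s :
  c \in chains k D -> c s != 0 -> s \in simplices k D.
Proof.
move=> cD; apply: contraNT => nsD.
rewrite /chains -[X in <<X>>%VS](in_tupleE) in cD.
rewrite (coord_span cD) sum_ffunE big1 // => i _.
have lti : (i < #|simplices k D|)%N by rewrite cardE -(size_map (@simplex_chain n)).
rewrite ffunE /= chains_nth // ffunE.
case: eqVneq => [sE|_]; last by rewrite scaler0.
by move: nsD; rewrite sE -mem_enum mem_nth -?cardE.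
Qed.

Lemma dim_chains k D : \dim (chains k D) = #|simplices k D|.
Proof.
rewrite cardE -(size_map (@simplex_chain n)); apply/eqP.
rewrite -/(free _) -[X in free X](in_tupleE); apply/freeP => a a0 i.
have lti : (i < #|simplices k D|)%N by rewrite cardE -(size_map (@simplex_chain n)).
move/ffunP/(_ (nth set0 (enum (simplices k D)) i)): a0.
rewrite sum_ffunE [RHS]ffunE (bigD1 i) //= big1 ?addr0.
  by rewrite ffunE chains_nth // ffunE eqxx /GRing.scale /= mulr1.
move=> j ji; have ltj : (j < #|simplices k D|)%N.
  by rewrite cardE -(size_map (@simplex_chain n)).
rewrite ffunE chains_nth // ffunE nth_uniq ?enum_uniq -?cardE //.
by rewrite eq_sym val_eqE (negbTE ji) scaler0.
Qed.

Lemma betti_top k D : simplices k.+1 D = set0 -> betti k D = \dim (cycles k D).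
Proof.
move=> S0; have B0 : boundaries k D = 0%VS.
  by rewrite /boundaries /chains S0 enum_set0 span_nil limg0.
rewrite /betti /homology -(dimv_cap_compl (cycles k D) (boundaries k D)).
by rewrite B0 capv0 dimv0.
Qed.

Lemma F2_natr_eq0 (m : nat) : (m%:R == 0 :> 'F_2) = ~~ odd m.
Proof. by rewrite -(dvdn_pcharf (pchar_Fp (isT : prime 2))) dvdn2. Qed.

Lemma F2_neq0 (a : 'F_2) : a != 0 -> a = 1.
Proof. by case: a => [[|[|m]] lt] // _; apply/val_inj. Qed.

(** Over the field with two elements the support of a nonzero cycle is an even
family: the coefficient of the boundary at [t] counts modulo 2 the members of the
support that have [t] as a facet. Positivity of [d] makes the facets of
[d]-simplices nonempty, so that the reduced parity condition at [set0] holds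
trivially. *)
Lemma circuit_of_betti d D : (0 < d)%N -> simplices d.+1 D = set0 ->
  (0 < betti d D)%N -> exists2 Z, circuit Z & Z \subset simplices d D.
Proof.
move=> d0 S0; rewrite betti_top // lt0n dimv_eq0 -vpick0.
set c := vpick _ => c0.
have /memv_capP[cD] : c \in cycles d D := memv_pick _.
rewrite memv_ker lfunE /= => /eqP bc.
pose Z := [set s | c s != 0].
have ZD : Z \subset simplices d D.
  by apply/subsetP => s; rewrite inE; exact: chains_support.
suff [Z0 cZ] : Z != set0 /\ mod2_cycle Z.
  have [Z' circ Z'Z] := circuit_exists Z0 cZ.
  by exists Z' => //; exact: subset_trans ZD.
split.
  apply: contra c0 => /eqP Z0; apply/eqP/ffunP => s; rewrite ffunE.
  by apply/eqP/negPn; have := in_set0 s; rewrite -Z0 inE => ->.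
apply/forallP => t; have [->|t0] := eqVneq t set0.
  rewrite (_ : [set s in Z | _] = set0) ?cards0 //; apply/setP => s; rewrite !inE.
  apply/negP => /andP[cs]; have := subsetP ZD s.
  rewrite !inE => /(_ cs)/andP[_ /eqP ss].
  by rewrite /facet ss cards0 eqSS eqn0Ngt d0 andbF.
rewrite -F2_natr_eq0; have /ffunP/(_ t) := bc; rewrite [RHS]ffunE boundaryE //.
move=> sum0; apply/eqP; rewrite -[RHS]sum0.
rewrite (bigID (mem Z)) /= [X in _ + X]big1 ?addr0.
  rewrite -sumr_const; apply: eq_big => [s|s]; first by rewrite inE andbC.
  by rewrite !inE => /andP[/F2_neq0 -> _].
by move=> s /andP[_]; rewrite inE negbK => /eqP.
Qed.

Lemma card_simplices_le k D : (#|simplices k D| <= 'C(n, k.+1))%N.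
Proof.
rewrite -[n in X in (_ <= X)%N]card_ord -cardsT -cards_draws.
by apply: subset_leq_card; apply/subsetP => s; rewrite !inE subsetT => /andP[].
Qed.

(** Without nonzero cycles the boundary map is injective on [d]-chains, and it
takes values in the [(d-1)]-chains. *)
Lemma few_simplices_of_betti0 d D : (0 < d)%N -> simplicial_complex D ->
  simplices d.+1 D = set0 -> betti d D = 0%N ->
  (#|simplices d D| <= 'C(n, d))%N.
Proof.
case: d => // d _ cD S0; rewrite betti_top // => /eqP.
rewrite dimv_eq0 => /eqP ker0.
rewrite -dim_chains -(limg_dim_eq ker0).
apply: leq_trans (_ : \dim (chains d D) <= _)%N; last first.
  by rewrite dim_chains card_simplices_le.
apply: dimvS; rewrite /chains limg_span -map_comp.
apply/span_subvP => _ /mapP[s sD ->]; rewrite mem_enum in sD.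
by rewrite /= lfunE /= boundary_simplex simplex_boundary_chains.
Qed.

End TopHomology.

(** * Random subsets of a finite set *)

Section RandomSubsets.
Variables (R : realFieldType) (T : finType).
Implicit Types (S A Z : {set T}) (a b p : R).

Lemma sum_subsets a b S :
  \sum_(A : {set T} | A \subset S) a ^+ #|A| * b ^+ (#|S| - #|A|) = (a + b) ^+ #|S|.
Proof.
rewrite addrC exprDn (partition_big (fun A => inord #|A| : 'I_#|S|.+1) xpredT) //=.
apply: eq_bigr => k _; rewrite -cards_draws -sumr_const.
under [RHS]eq_bigl do rewrite inE.
apply: eq_big => [A|A /andP[AS /eqP <-]].
  case AS: (A \subset S) => //=.
  by rewrite -val_eqE /= inordK // ltnS subset_leq_card.
by rewrite inordK ?ltnS ?subset_leq_card // mulrC.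
Qed.

Lemma sum_supersets p S Z : Z \subset S ->
  \sum_(A : {set T} | (A \subset S) && (Z \subset A))
    p ^+ #|A| * (1 - p) ^+ (#|S| - #|A|) = p ^+ #|Z|.
Proof.
move=> ZS.
rewrite (reindex_onto (fun B => Z :|: B) (fun A => A :\: Z)) /=; last first.
  by move=> A /andP[_ ZA]; rewrite -[RHS](setID A Z) (setIidPr ZA).
have cSZ : #|S :\: Z| = (#|S| - #|Z|)%N by rewrite cardsD (setIidPr ZS).
transitivity (p ^+ #|Z| * (p + (1 - p)) ^+ #|S :\: Z|); last first.
  by rewrite addrC subrK expr1n mulr1.
rewrite -sum_subsets big_distrr /=; apply: eq_big => [B|B].
  rewrite subUset ZS subsetUl andbT /= subsetD.
  congr (_ && _); rewrite setDUl setDv set0U.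
  apply/eqP/idP => [<-|/setDidPl //].
  by rewrite disjoint_sym disjoints_subset setDE setCI setCK subsetUr.
move=> /andP[_ /eqP BE].
have dis : [disjoint Z & B].
  rewrite -BE disjoint_sym; apply/setDidPl.
  by rewrite setDDl setUid.
by rewrite cardsU (disjoint_setI0 dis) cards0 subn0 exprD cSZ subnDA mulrA.
Qed.

Lemma ler_sum_sub (I : finType) (P Q : pred I) (F : I -> R) :
  (forall i, P i -> Q i) -> (forall i, Q i -> 0 <= F i) ->
  \sum_(i | P i) F i <= \sum_(i | Q i) F i.
Proof.
move=> PQ F0; rewrite big_mkcond [leRHS]big_mkcond; apply: ler_sum => i _.
by case Pi: (P i); [rewrite PQ | case Qi: (Q i) => //; exact: F0].
Qed.

Lemma subset_mass_ge0 p S A : 0 <= p <= 1 ->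
  0 <= p ^+ #|A| * (1 - p) ^+ (#|S| - #|A|).
Proof. by case/andP=> p0 p1; rewrite mulr_ge0 ?exprn_ge0 // subr_ge0. Qed.

(** Union bound: by [sum_supersets], the random subset contains a given [Z] with
probability [p ^+ #|Z|]. *)
Lemma prob_contains_le p S (C : pred {set T}) : 0 <= p <= 1 ->
  \sum_(A : {set T} | (A \subset S) && [exists Z, C Z && (Z \subset A)])
     p ^+ #|A| * (1 - p) ^+ (#|S| - #|A|)
  <= \sum_(Z : {set T} | C Z && (Z \subset S)) p ^+ #|Z|.
Proof.
move=> p01.
under [leRHS]eq_bigr => Z /andP[_ ZS] do rewrite -(sum_supersets p ZS).
rewrite (exchange_big_dep (fun A => A \subset S)) /=; last by move=> Z A _ /andP[].
rewrite big_mkcondr /=; apply: ler_sum => A AS.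
case: ifP => [/existsP[Z /andP[CZ ZA]]|_]; last first.
  by apply: sumr_ge0 => Z _; exact: subset_mass_ge0.
rewrite (bigD1 Z) /=; last by rewrite CZ AS ZA (subset_trans ZA).
by rewrite lerDl; apply: sumr_ge0 => Z' _; exact: subset_mass_ge0.
Qed.

(** Markov's inequality for [2 ^ (K - #|A|)], whose expectation is given by the
binomial formula. *)
Lemma prob_card_le p S K : 0 <= p <= 1 ->
  \sum_(A : {set T} | (A \subset S) && (#|A| <= K)%N)
     p ^+ #|A| * (1 - p) ^+ (#|S| - #|A|)
  <= 2 ^+ K * (1 - p / 2) ^+ #|S|.
Proof.
move=> /andP[p0 p1].
have -> : 1 - p / 2 = p / 2 + (1 - p) by field.
rewrite -sum_subsets big_distrr /= big_mkcondr /=; apply: ler_sum => A AS.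
have q0 : 0 <= 1 - p by rewrite subr_ge0.
case: ifP => [cA|_]; last by rewrite !mulr_ge0 ?exprn_ge0 ?divr_ge0.
rewrite mulrA ler_wpM2r ?exprn_ge0 // expr_div_n mulrA mulrAC.
rewrite ler_peMl ?exprn_ge0 // ler_pdivlMr ?exprn_gt0 // mul1r.
by rewrite ler_weXn2l // ler1n.
Qed.

Lemma geometric_tail_le (x : R) v M : 0 <= x <= 2^-1 ->
  \sum_(m < M | (v <= m)%N) x ^+ m <= 2 * x ^+ v.
Proof.
move=> /andP[x0 x2].
suff : \sum_(m < M | (v <= m)%N) x ^+ m + 2 * x ^+ (maxn v M) <= 2 * x ^+ v.
  by apply: le_trans; rewrite lerDl mulr_ge0 ?exprn_ge0.
elim: M => [|M IHM]; first by rewrite big_ord0 add0r maxn0.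
apply: le_trans IHM.
rewrite big_mkcond big_ord_recr /= -big_mkcond /= -addrA lerD2l.
case: leqP => vM; last by rewrite add0r (maxn_idPl vM).
rewrite (maxn_idPr (leqW vM)) exprS.
have := exprn_ge0 M x0; move: (x ^+ M) => y y0; nra.
Qed.

End RandomSubsets.

(** * Random complexes *)

Section RandomComplexes.
Variables (R : realFieldType) (n : nat) (p : R) (d : nat).
Hypotheses (p01 : 0 <= p <= 1) (d0 : (0 < d)%N).

Let S : {set {set 'I_n}} := [set s : {set 'I_n} | #|s| == d.+1].

Lemma card_all_simplices : #|S| = 'C(n, d.+1).
Proof.
rewrite -[n in RHS]card_ord -cardsT -cards_draws.
by apply: eq_card => s; rewrite !inE subsetT.
Qed.

(** A complex of the model is the full [(d-1)]-skeleton together with its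
[d]-simplices. *)
Lemma simplices_inj : {in Y_space n d &, injective (simplices d)}.
Proof.
have memD D s : D \in Y_space n d -> (s \in D) =
    (s \in skeleton d.-1 (full_simplex n)) || (s \in simplices d D).
  move=> YD; have := YD; rewrite inE => /and3P[_ /eqP <- _].
  rewrite !inE prednK //; have [sD|//] := boolP (s \in D).
  by rewrite /= orbC -leq_eqVlt (Y_space_card d0 YD).
by move=> D D' YD YD' eqS; apply/setP => s; rewrite (memD _ _ YD) (memD _ _ YD') eqS.
Qed.

(** Transfers a bad event to the random set of [d]-simplices. Injectivity of
[simplices d] suffices for this inequality, whence the one-sided form. *)
Lemma Y_prob_le (E P : pred {set {set 'I_n}}) :
  (forall D, D \in Y_space n d -> E D -> P (simplices d D)) ->
  Y_prob p d E <= \sum_(A : {set {set 'I_n}} | (A \subset S) && P A)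
    p ^+ #|A| * (1 - p) ^+ (#|S| - #|A|).
Proof.
move=> EP; pose X := [set D in Y_space n d | E D].
rewrite /Y_prob (eq_bigl (mem X)); last by move=> D; rewrite /= [RHS]inE.
rewrite /Y_mass -card_all_simplices.
pose mass (A : {set {set 'I_n}}) := p ^+ #|A| * (1 - p) ^+ (#|S| - #|A|).
rewrite -(big_imset (h := simplices d) mass) /=.
  apply: ler_sum_sub => [A /imsetP[D]|A _]; last exact: subset_mass_ge0.
  rewrite inE => /andP[YD ED] ->; rewrite EP // andbT.
  by apply/subsetP => s; rewrite !inE => /andP[].
move=> D D'; rewrite inE => /andP[YD _]; rewrite inE => /andP[YD' _].
by move=> eqS; apply: (simplices_inj YD YD').
Qed.

Lemma Y_prob_compl (E : pred {set {set 'I_n}}) :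
  Y_prob p d E = 1 - Y_prob p d (predC E).
Proof.
rewrite -(@Y_prob_total R n p d d0) /Y_prob.
under [X in _ = X - _]eq_bigl do rewrite andbT.
by rewrite [X in _ = X - _](bigID E) /= addrK.
Qed.

Lemma Y_prob_ge0 (E : pred {set {set 'I_n}}) : 0 <= Y_prob p d E.
Proof.
case/andP: p01 => p0 p1.
by apply: sumr_ge0 => D _; rewrite mulr_ge0 ?exprn_ge0 // subr_ge0.
Qed.

Lemma prob_betti0_le :
  Y_prob p d (fun D : {set {set 'I_n}} => betti d D == 0%N)
  <= 2 ^+ 'C(n, d) * (1 - p / 2) ^+ 'C(n, d.+1).
Proof.
rewrite -card_all_simplices; apply: le_trans (prob_card_le _ _ p01).
apply: (Y_prob_le (P := fun A => (#|A| <= 'C(n, d))%N)) => D.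
rewrite inE => /and3P[cD _ /eqP S0] /eqP b0.
exact: few_simplices_of_betti0.
Qed.

(** The number of members of a circuit is at least the number of its vertices, so
the sum over the number [m] of members is a geometric tail starting at
[m = #|V|], of ratio [#|V| * p <= n * p <= 1 / 2]. *)
Lemma sum_circuits_on_le (V : {set 'I_n}) : p * n%:R <= 2^-1 ->
  \sum_(Z : {set {set 'I_n}} | [&& circuit Z, Z \subset S & cover Z == V]) p ^+ #|Z|
  <= (#|V| ^ d)%:R * (2 * (#|V|%:R * p) ^+ #|V|).
Proof.
move=> pn; have /andP[p0 p1] := p01; set v := #|V|; pose M := #|{set 'I_n}|.
have vp : 0 <= v%:R * p <= 2^-1.
  rewrite mulr_ge0 //= (le_trans _ pn) // mulrC ler_wpM2l // ler_nat.
  by rewrite -[leqRHS]card_ord max_card.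
rewrite (partition_big (fun Z : {set {set 'I_n}} => inord #|Z| : 'I_M.+1)
  (fun m => (v <= m)%N)) /=; last first.
  move=> Z /and3P[cZ ZS /eqP VE]; rewrite /v -VE inordK ?ltnS ?max_card //.
  exact: card_cover_cycle (circuit_cycle cZ) ZS.
apply: le_trans (ler_wpM2l (ler0n _ _) (geometric_tail_le v M.+1 vp)).
rewrite big_distrr /=; apply: ler_sum => m _.
pose C := [set Z | [&& circuit Z, Z \subset S, cover Z \subset V & #|Z| == m]].
apply: (@le_trans _ _ (\sum_(Z in C) p ^+ m)).
  rewrite (eq_bigr (fun=> p ^+ m)); last first.
    by move=> Z /andP[_ /eqP <-]; rewrite inordK // ltnS max_card.
  apply: ler_sum_sub => [Z|Z _]; last exact: exprn_ge0.
  move=> /andP[/and3P[cZ ZS /eqP VE] /eqP mE].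
  by rewrite inE cZ ZS VE subxx -mE inordK ?eqxx // ltnS max_card.
rewrite sumr_const -[leLHS]mulr_natl exprMn mulrA ler_wpM2r ?exprn_ge0 //.
by rewrite -natrX -natrM -expnD ler_nat card_circuits_on.
Qed.

(** The factor [v ^ v] in [(v p) ^ v] is absorbed by [C(n, v) v ^ v <= (4 n) ^ v]
and the factor [v ^ d] by [v ^ d <= 2 ^ (v + d) d!], which leaves a geometric
series of ratio [8 n p]. *)
Lemma prob_betti_gt0_le : p * n%:R <= 16^-1 ->
  Y_prob p d (fun D : {set {set 'I_n}} => (0 < betti d D)%N)
  <= (2 ^ (d + 5) * d`!)%:R * (p * n%:R).
Proof.
move=> pn16; have /andP[p0 p1] := p01.
have pn0 : 0 <= p * n%:R by rewrite mulr_ge0.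
have pn : p * n%:R <= 2^-1 by lra.
apply: le_trans (Y_prob_le (P := fun A =>
  [exists Z, circuit Z && (Z \subset A)]) _) _.
  move=> D; rewrite inE => /and3P[_ _ /eqP S0] bD.
  have [Z cZ ZD] := circuit_of_betti d0 S0 bD.
  by apply/existsP; exists Z; rewrite cZ.
apply: le_trans (prob_contains_le S (@circuit _) p01) _.
rewrite (partition_big (@cover _) xpredT) //=.
pose g v : R := (v ^ d)%:R * (2 * (v%:R * p) ^+ v).
apply: (@le_trans _ _ (\sum_(V : {set 'I_n}) g #|V|)).
  apply: ler_sum => V _; apply: le_trans (sum_circuits_on_le V pn).
  by under eq_bigl do rewrite -andbA.
rewrite (partition_big (fun V : {set 'I_n} => inord #|V| : 'I_n.+1) xpredT) //=.
have card_lt (V : {set 'I_n}) : (#|V| < n.+1)%N.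
  by rewrite ltnS -[leqRHS]card_ord max_card.
apply: (@le_trans _ _ (\sum_(v < n.+1 | (1 <= v)%N)
    (2 ^ d.+1 * d`!)%:R * (8 * (p * n%:R)) ^+ v)); last first.
  rewrite -big_distrr /=.
  apply: le_trans (ler_wpM2l (ler0n _ _) (geometric_tail_le _ _ _)) _.
    by apply/andP; split; lra.
  rewrite expr1 (_ : 2 * (8 * (p * n%:R)) = 16%:R * (p * n%:R)); last by ring.
  rewrite [leLHS]mulrA -natrM ler_wpM2r // ler_nat mulnAC leq_mul2r.
  by rewrite expnD expnS; lia.
rewrite [leRHS]big_mkcond; apply: ler_sum => v _.
rewrite (eq_bigr (fun=> g v)); last first.
  by move=> V /eqP <-; rewrite inordK.
have -> : \sum_(V : {set 'I_n} | inord #|V| == v) g v = 'C(n, v)%:R * g v.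
  rewrite sumr_const mulr_natl; congr (_ *+ _).
  have := cards_draws [set: 'I_n] v; rewrite cardsT card_ord => <-.
  apply: eq_card => V.
  by rewrite [RHS]inE subsetT unfold_in /= inordK.
(* The empty vertex set contributes nothing since [0 ^ d = 0]; this is why the
   series starts at [v = 1] and is small with [n p]. *)
rewrite lt0n; have [v0|v_gt0] := posnP v.
  by rewrite /g v0 exp0n // mul0r mulr0.
have bnd : ('C(n, v) * v ^ d * (2 * v ^ v) <= 2 ^ d.+1 * d`! * (8 * n) ^ v)%N.
  apply: (@leq_trans (2 * (2 ^ (v + d) * d`!) * (4 * n) ^ v)).
    have -> : ('C(n, v) * v ^ d * (2 * v ^ v) = 2 * v ^ d * ('C(n, v) * v ^ v))%N.
      by ring.
    by rewrite leq_mul ?bin_expn_le // leq_mul2l leq_expn_fact.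
  by rewrite (_ : 8 * n = 2 * (4 * n))%N ?(expnMn 2) ?expnD ?expnS; lia.
have -> : 'C(n, v)%:R * g v = ('C(n, v) * v ^ d * (2 * v ^ v))%:R * p ^+ v.
  by rewrite /g exprMn !natrM !natrX; ring.
have -> : (2 ^ d.+1 * d`!)%:R * (8 * (p * n%:R)) ^+ v
   = (2 ^ d.+1 * d`! * (8 * n) ^ v)%:R * p ^+ v.
  by rewrite !exprMn !natrM !natrX natrM exprMn; ring.
by rewrite ler_wpM2r ?exprn_ge0 // ler_nat.
Qed.

End RandomComplexes.

(** * The threshold *)

(** With [K = C(n, d)] and [N = C(n, d+1)], the identity [(d+1) N = (n-d) K] gives
[N p / 2 >= K q] for [q = n p / (4 (d+1))] as soon as [n >= 2 d]. Then
[2 ^ K (1 - p/2) ^ N <= (2 exp(-q)) ^ K <= (2 / (1 + q)) ^ K], and [K >= 1]. *)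
Lemma prob_betti0_le_inv (R : realType) (n : nat) (p : R) (d : nat) :
  0 <= p <= 1 -> (0 < d)%N -> (2 * d <= n)%N ->
  4 * d.+1%:R <= p * n%:R ->
  Y_prob p d (fun D : {set {set 'I_n}} => betti d D == 0%N)
  <= 8 * d.+1%:R / (p * n%:R).
Proof.
move=> p01 d0 dn pn; have /andP[p0 p1] := p01.
apply: le_trans (prob_betti0_le n p01 d0) _.
set K := 'C(n, d); set N := 'C(n, d.+1).
have D0 : 0 < d.+1%:R :> R by rewrite ltr0n.
pose q := p * n%:R / (4 * d.+1%:R).
have q1 : 1 <= q by rewrite /q ler_pdivlMr ?mul1r ?mulr_gt0.
have qK : K%:R * q <= N%:R * (p / 2).
  have NE : d.+1%:R * N%:R = (n%:R - d%:R) * K%:R :> R.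
    by rewrite -natrB ?(leq_trans _ dn) ?leq_pmull // -!natrM mul_bin_left.
  have dn' : 2 * d%:R <= n%:R :> R by rewrite -natrM ler_nat.
  have KE : K%:R * q = p * (n%:R * K%:R) / (4 * d.+1%:R) by rewrite /q; field; lra.
  have NE' : N%:R * (p / 2) = p * (2 * ((n%:R - d%:R) * K%:R)) / (4 * d.+1%:R).
    by rewrite -NE; field; lra.
  rewrite KE NE' ler_wpM2r ?invr_ge0 ?mulr_ge0 // ler_wpM2l //.
  by rewrite mulrA ler_wpM2r //; lra.
have qinv : 2 ^+ K * (1 - p / 2) ^+ N <= (2 / (1 + q)) ^+ K.
  rewrite expr_div_n ler_wpM2l ?exprn_ge0 //.
  have E : (1 - p / 2) ^+ N <= expR (- (p / 2)) ^+ N.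
    by rewrite lerXn2r ?nnegrE ?expR_ge0 ?expR_ge1Dx //; lra.
  apply: le_trans E _; rewrite -expRM_natl mulrN expRN.
  rewrite lef_pV2 ?posrE ?expR_gt0 ?exprn_gt0 //; last by lra.
  apply: le_trans (_ : expR (K%:R * q) <= _); last by rewrite ler_expR.
  by rewrite expRM_natl lerXn2r ?nnegrE ?expR_ge0 ?expR_ge1Dx //; lra.
apply: le_trans qinv _.
have q21 : 2 / (1 + q) <= 1 by rewrite ler_pdivrMr; lra.
apply: (@le_trans _ _ (2 / (1 + q))).
  rewrite ler_iXnr ?bin_gt0 ?q21 ?divr_ge0 //; try lra.
  by rewrite (leq_trans _ dn) ?leq_pmull.
have -> : 8 * d.+1%:R / (p * n%:R) = 2 / q.
  by rewrite /q invf_div mulrA; congr (_ / _); ring.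
by rewrite ler_pM2l ?lef_pV2 ?posrE; lra.
Qed.

Local Open Scope classical_set_scope.
Local Open Scope ring_scope.

Theorem theorem2p1 (R : realType) (d : nat) (p w : nat -> R)
  (hd : (1 <= d)%N)
  (hpw : forall n : nat, (0 < n)%N -> p n = w n / n%:R)
  (hp : forall n : nat, (0 < n)%N -> 0 <= p n <= 1) :
  (w n @[n --> \oo] --> (0 : R) ->
   Y_prob (n := n) (p n) d (fun D => betti d D == 0%N) @[n --> \oo] --> (1 : R))
  /\
  (w n @[n --> \oo] --> +oo ->
   Y_prob (n := n) (p n) d (fun D => (0 < betti d D)%N) @[n --> \oo] --> (1 : R)).
Proof.
have pn n : (0 < n)%N -> p n * n%:R = w n.
  by move=> n0; rewrite hpw // divfK // pnatr_eq0 -lt0n.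
split=> hw.
- pose C : R := (2 ^ (d + 5) * d`!)%:R.
  apply: (@squeeze_cvgr _ _ _ _ (fun n => 1 - C * w n) (fun=> 1)); first last.
  + exact: cvg_cst.
  + rewrite -[X in _ --> X]subr0 -[X in _ --> _ - X](mulr0 C).
    by apply: cvgB; [exact: cvg_cst | exact: cvgMl_tmp].
  + near=> n.
    have n0 : (0 < n)%N by near: n; exact: nbhs_infty_ge.
    have w16 : w n <= 16^-1.
      by near: n; apply: (cvgr_le (0 : R)); rewrite ?invr_gt0.
    rewrite Y_prob_compl // lerD2l lerN2 gerBl.
    rewrite Y_prob_ge0 ?hp // andbT.
    under [X in Y_prob _ _ X]funext => D do rewrite /= -lt0n.
    by rewrite -pn // prob_betti_gt0_le ?hp ?pn.
- apply: (@squeeze_cvgr _ _ _ _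
    (fun n => 1 - 8 * d.+1%:R / w n) (fun=> 1)); first last.
  + exact: cvg_cst.
  + rewrite -[X in _ --> X]subr0 -[X in _ --> _ - X](mulr0 (8 * d.+1%:R)).
    apply: cvgB; first exact: cvg_cst.
    apply: cvgMl_tmp; exact/(gtr0_cvgV0 (cvgry_gt hw 0)).
  + near=> n.
    have n0 : (0 < n)%N by near: n; exact: nbhs_infty_ge.
    have dn : (2 * d <= n)%N by near: n; exact: nbhs_infty_ge.
    have wd : 4 * d.+1%:R <= w n by near: n; apply: cvgry_ge.
    rewrite Y_prob_compl // lerD2l lerN2 gerBl.
    rewrite Y_prob_ge0 ?hp // andbT.
    under [X in Y_prob _ _ X]funext => D do rewrite /= -eqn0Ngt.
    by rewrite -pn // prob_betti0_le_inv ?hp ?pn.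
Unshelve. all: by end_near.
Qed.
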